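(* Let the edge passage times $X_e$ be i.i.d. positive random variables with tail probability function $H(y)=\mathbb{P}(X_e>y)$, and suppose that the essential supremum $\mu=\inf\{y:\mathbb{P}(X_e>y)=0\}$ of $X_e$ is finite. Then for any $0<x<\mu$ with $p=p(x)=H(\mu-x)<1$, there exist constants $C_1>1$, $c_1>1$ and $c_2>C_2>0$ such that $$c_1^{\,n}e^{-c_2n^2}\le\mathbb{P}\left(\frac{W_n}{n}\le\mu-x\right)\le C_1^{\,n}e^{-C_2n^2}$$ for all large enough $n$.
   Context: Last passage percolation on the complete graph. $G_n=([n],E_n)$ is the complete graph on $[n]=\{1,\dots,n\}$, with $E_n=\{\langle i,j\rangle:1\le i<j\le n\}$. Each edge $e\in E_n$ carries a positive random passage time $X_e$, and $\{X_e:e\in E_n\}$ are independent and identically distributed, with a common law not depending on $n$. For $n\ge2$, $\Pi_{1,n}$ is the set of all self-avoiding paths in $G_n$ from vertex $1$ to vertex $n$ (no repeated vertices). The passage time of a path $\pi$ is $T(\pi)=\sum_{e\in\pi}X_e$, and $W_n=\sup_{\pi\in\Pi_{1,n}}T(\pi)$. The constants $C_1,c_1,C_2,c_2$ may depend on $x$ and on the law of $X_e$, but not on $n$. *)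

(* Defs.v *)
From HB Require Import structures.
From mathcomp Require Import all_boot all_order all_algebra.
From mathcomp Require Import all_classical all_reals all_analysis.
From mathcomp Require Import measurable_realfun ess_sup_inf.

Set Implicit Arguments.
Unset Strict Implicit.
Unset Printing Implicit Defensive.

Import Order.TTheory GRing.Theory Num.Theory.
Import numFieldNormedType.Exports.

Local Open Scope classical_set_scope.
Local Open Scope ring_scope.

(* The vertex set [n] = {1, .., n} is 'I_n, shifted by one: vertex 1 is the
   ordinal of value 0 and vertex n the ordinal of value n - 1. *)
Definition edge (n : nat) : finType := {e : 'I_n * 'I_n | (e.1 < e.2)%N}.

Definition self_avoiding_path (n : nat) (p : seq 'I_n) : bool :=
  if p is v :: q then
    [&& val v == 0%N, path (fun i j => i != j) v q,
        (val (last v q)).+1 == n & uniq p]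
  else false.

(* A step of the path from i to j with j < i traverses the edge (j, i). *)
Definition path_edges (n : nat) (p : seq 'I_n) : {set edge n} :=
  [set e : edge n | let s := zip p (behead p) in
     (((val e).1, (val e).2) \in s) || (((val e).2, (val e).1) \in s)]%SET.

Section passage_times.
Context d (T : measurableType d) (R : realType) (P : probability T R).

(* Mutual independence of a finite family: the product rule over every
   subfamily. *)
Definition independent_RVs (I : finType) (X : I -> {RV P >-> R}) : Prop :=
  forall (J : {set I}) (B : I -> set R), (forall i, measurable (B i)) ->
    P (\bigcap_(i in [set` J]) (X i @^-1` B i))
    = (\prod_(i in J) P (X i @^-1` B i))%E.

Definition iid_copies d0 (T0 : measurableType d0) (P0 : probability T0 R)
    (xi : {RV P0 >-> R}) (I : finType) (X : I -> {RV P >-> R}) : Prop :=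
  independent_RVs X /\
  forall (i : I) (A : set R), measurable A ->
    distribution P (X i) A = distribution P0 xi A.

Definition passage_time (n : nat) (X : edge n -> {RV P >-> R})
    (p : seq 'I_n) (w : T) : R :=
  \sum_(e in path_edges p) X e w.

Definition last_passage_time (n : nat) (X : edge n -> {RV P >-> R})
    (w : T) : R :=
  sup [set passage_time X p w | p in [set p | self_avoiding_path p]].

(* The library's essential supremum of X is inf {y : P(X > y) = 0}. *)
Lemma ess_sup_ccdf (X : {RV P >-> R}) :
  ess_supr P X = ereal_inf [set y%:E | y in [set y | ccdf X y = 0%E]].
Proof.
have mX : measurable_fun setT (EFin \o X : T -> \bar R) by exact/measurable_EFinP.
have E (y : R) : (EFin \o X) @^-1` `]y%:E, +oo[ = X @^-1` `]y, +oo[.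
  by apply/seteqP; split=> t /=; rewrite !in_itv /= !andbT ?lte_fin.
rewrite (ess_supEmu0 P mX); apply/eqP; rewrite eq_le; apply/andP; split.
  by apply: ereal_inf_le_tmp => _ [y /= y0 <-] /=; rewrite E.
apply: le_ereal_inf_tmp => -[y| |] /= y0; last 2 first.
- exact: leey.
- have := @probability_setT _ _ _ P.
  have -> : [set: T] = (EFin \o X) @^-1` `](-oo)%E, +oo[.
    apply/seteqP; split=> t //= _; rewrite in_itv /=.
    by rewrite ltNyr.
  by rewrite y0 => /esym/eqP; rewrite onee_eq0.
by apply: ereal_inf_lbound; exists y => //=; rewrite -y0 E.
Qed.

End passage_times.

(* Main.v *)
(* Lower bound: if all edges have passage time at most mu - x, then so does
   W_n / n, and there are n (n - 1) / 2 edges.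

   Upper bound: let a := mu - x / 2 and call an edge light if X_e <= a, which
   has probability < 1. Build a Hamiltonian path from 1 to n greedily, always
   stepping along a non-light edge to an unvisited vertex if there is one. A
   vertex from which this is impossible has only light edges to all vertices
   visited later, so the vertices B at which the path gets stuck span only light
   edges. Since all other steps have weight > a, W_n <= (mu - x) n forces
   |B| > delta n with delta := x / (4 a). A given B spans only light edges with
   probability exp (- beta |B| (|B| - 1) / 2), and there are at most 2^n sets. *)
Require Import Defs.
From HB Require Import structures.
From mathcomp Require Import all_boot all_order all_algebra.
From mathcomp Require Import all_classical all_reals all_analysis.
From mathcomp Require Import measurable_realfun ess_sup_inf.
From mathcomp Require Import ring lra.

Set Implicit Arguments.
Unset Strict Implicit.
Unset Printing Implicit Defensive.

Import Order.TTheory GRing.Theory Num.Theory.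
Import numFieldNormedType.Exports.

Local Open Scope classical_set_scope.
Local Open Scope ring_scope.

(** * Greedy paths for symmetric nonnegative weights *)

(** Induction on the number of unvisited vertices. The order of visits is [t], and [B] collects the
    stuck vertices: a step from outside [B] gains at least [a], a step from [B] at least 0. The
    inclusion of [B] in [v :: s] makes the induction work: a stuck [v] is compared with all of [s],
    hence with every later member of [B]. *)
Lemma greedy_path (V : eqType) (R : realDomainType) (w : V -> V -> R) (a : R)
    (v : V) (s : seq V) :
  (forall i j, w i j = w j i) -> (forall i j, 0 <= w i j) -> uniq (v :: s) ->
  exists t B, [/\ perm_eq t s, uniq B, {subset B <= v :: s},
    {in B &, forall i j, i != j -> w i j <= a} &
    a *+ size s <= \sum_(q <- zip (v :: t) t) w q.1 q.2 + a *+ size B].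
Proof.
move=> wC w0; move: {2}(size s) (erefl (size s)) => m.
elim: m v s => [|m IH] v s.
  by move=> /size0nil ->; exists [::], [::]; split; rewrite ?big_nil //= addr0.
move=> ss us; have /andP[vs us'] := us.
(* Both cases move to some [u] in [s] and continue on [rem u s]. *)
have step u : u \in s -> exists t B,
    [/\ perm_eq t (rem u s), uniq B, {subset B <= s},
      {in B &, forall i j, i != j -> w i j <= a} &
      a *+ m <= \sum_(q <- zip (u :: t) t) w q.1 q.2 + a *+ size B].
  move=> us1; have sr : size (rem u s) = m by rewrite size_rem// ss.
  have pr := perm_to_rem us1.
  have [|t [B [h1 h2 h3 h4 h5]]] := IH u (rem u s) sr.
    by rewrite -(perm_uniq pr).
  exists t, B; split=> //; first by move=> i /h3; rewrite (perm_mem pr).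
  by rewrite -[m in leLHS]sr.
case: (boolP (has (fun u => a < w v u) s)) => [/hasP[u us1 awu]|/hasPn nb].
  have [t [B [h1 h2 h3 h4 h5]]] := step u us1.
  exists (u :: t), B; split => //.
  - by rewrite perm_sym (permPl (perm_to_rem us1)) perm_cons perm_sym.
  - by move=> i /h3; rewrite inE => ->; rewrite orbT.
  - by rewrite ss mulrS /= big_cons -addrA lerD// ltW.
(* Here [v] is stuck and joins [B]. The next vertex is arbitrary, so the head of the list is
   taken. *)
case: s ss us vs us' step nb => [|u s]// ss us vs us' step nb.
have us1 : u \in u :: s by rewrite mem_head.
have [t [B [h1 h2 h3 h4 h5]]] := step u us1.
have vB : v \notin B by apply: contra vs => /h3.
exists (u :: t), (v :: B); split => //.
- by rewrite perm_sym (permPl (perm_to_rem us1)) perm_cons perm_sym.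
- by rewrite /= vB.
- by move=> i; rewrite !inE => /orP[->//|/h3]; rewrite inE => ->; rewrite orbT.
- move=> i j; rewrite !inE => /predU1P[->|iB] /predU1P[->|jB].
  + by rewrite eqxx.
  + by move=> _; rewrite leNgt; apply: nb; apply: h3.
  + by move=> _; rewrite wC leNgt; apply: nb; apply: h3.
  + exact: h4.
- rewrite ss /= mulrS big_cons /= mulrS.
  have := w0 v u; lra.
Qed.

(** * Edge sets of paths in the complete graph *)

Lemma uniq_path_neq (V : eqType) (v : V) (s : seq V) :
  uniq (v :: s) -> path (fun i j => i != j) v s.
Proof.
elim: s v => [//|u s IH] v /= /andP[]; rewrite inE negb_or => /andP[-> _] us.
exact: IH.
Qed.

(** Symmetric extension of [f] to ordered pairs, made without building an edge from [i] and [j]: the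
    sum has one term if [i != j] and is empty on the diagonal. *)
Definition edge_weight (R : nmodType) n (f : edge n -> R) (i j : 'I_n) : R :=
  \sum_(e in path_edges [:: i; j]) f e.

Lemma path_edges2 n (i j : 'I_n) (e : edge n) :
  (e \in path_edges [:: i; j]) = (val e == (i, j)) || (val e == (j, i)).
Proof.
rewrite inE /= !inE; case: (val e) => a b /=.
by congr (_ || _); rewrite !xpair_eqE andbC.
Qed.

Lemma edge_weightC (R : nmodType) n (f : edge n -> R) i j :
  edge_weight f i j = edge_weight f j i.
Proof. by apply: eq_bigl => e; rewrite !path_edges2 orbC. Qed.

Lemma edge_weightE (R : nmodType) n (f : edge n -> R) (e : edge n) :
  edge_weight f (val e).1 (val e).2 = f e.
Proof.
rewrite /edge_weight (big_pred1 e)// => e'.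
rewrite path_edges2 -surjective_pairing.
apply/orP/eqP => [[/eqP/val_inj//|/eqP E]|->]; last by left.
by have := valP e'; rewrite E /= ltnNge ltnW// (valP e).
Qed.

Lemma mem_zip (S T : eqType) (s : seq S) (t : seq T) i j :
  (i, j) \in zip s t -> (i \in s) && (j \in t).
Proof.
elim: s t => [|x s IH] [|y t]//=; rewrite !inE xpair_eqE.
by case/orP => [/andP[-> ->]//|/IH/andP[-> ->]]; rewrite !orbT.
Qed.

(** A set of edges forgets multiplicities, but a path without repeated vertices crosses each edge
    once: the first edge contains [v] and no later edge does. With values in any [nmodType], the
    identity also serves to count edges. *)
Lemma sum_path_edges (R : nmodType) n (f : edge n -> R) (v : 'I_n) s :
  uniq (v :: s) ->
  \sum_(e in path_edges (v :: s)) f e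
    = \sum_(q <- zip (v :: s) s) edge_weight f q.1 q.2.
Proof.
elim: s v => [|u s IH] v.
  by move=> _; rewrite big_nil big_pred0// => e; rewrite inE /=.
move=> us; have /andP[vs us'] := us.
rewrite big_cons /= -IH // -bigU /=.
  by apply: eq_bigl => e; rewrite !inE /= !inE orbACA.
apply/pred0P => e /=; apply/negbTE/negP => /andP[].
rewrite path_edges2 inE /= => evu es.
have : v \in u :: s.
  have tl j : j \in s -> j \in u :: s by rewrite inE orbC => ->.
  by case/orP: evu es => /eqP -> /orP[] /mem_zip /andP[] // _ /tl.
by rewrite (negbTE vs).
Qed.

Lemma card_path_edges n (v : 'I_n) s :
  uniq (v :: s) -> (#|path_edges (v :: s)| <= size s)%N.
Proof.
move=> us; rewrite -sum1_card (sum_path_edges _ us).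
(* At most one edge joins [i] and [j], since an edge lists its smaller end first. *)
have w1 i j : (edge_weight (fun _ : edge n => 1%N) i j <= 1)%N.
  rewrite /edge_weight sum1_card; apply/card_le1_eqP => e e'.
  have := valP e; have := valP e'; rewrite !path_edges2 => h' h.
  case/orP => /eqP E /orP[] /eqP E'; apply: val_inj; rewrite E E' //.
    by move: h h'; rewrite E E' /= => h; rewrite ltnNge ltnW.
  by move: h h'; rewrite E E' /= => h; rewrite ltnNge ltnW.
elim: s v {us} => [|u s IH] v; first by rewrite big_nil.
by rewrite big_cons; exact: leq_add (w1 v u) (IH u).
Qed.

(** * Counting the edges of complete subgraphs *)

Definition clique n (B : {set 'I_n}) : {set edge n} :=
  [set e | ((val e).1 \in B) && ((val e).2 \in B)]%SET.

Lemma card_clique n (B : {set 'I_n}) : (#|clique B|.*2 = #|B| * #|B|.-1)%N.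
Proof.
have -> : #|clique B| = (\sum_(i in B) \sum_(j in B) (i < j)%N)%N.
  rewrite pair_big -(card_imset _ val_inj) -big_mkcondr sum1_card.
  apply: eq_card => -[i j]; rewrite [RHS]unfold_in /=.
  apply/imsetP/andP => [[e]|[/andP[iB jB] ij]].
    by rewrite inE => e12 E; rewrite -[i]/(i, j).1 -[j]/(i, j).2 E;
      split=> //; exact: valP e.
  by exists (exist _ (i, j) ij : edge n); rewrite ?inE /= ?iB.
(* Swapping the sums in one of the two copies turns [i < j] into [j < i]; together they count each
   [j != i] in [B] once. *)
rewrite -addnn [X in (_ + X)%N]exchange_big -big_split /= -sum_nat_const.
apply: eq_bigr => i iB; rewrite -big_split /= (cardD1 i) iB /= -sum1_card.
rewrite (bigD1 i)//= ltnn add0n.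
rewrite [RHS](eq_bigl (fun j => (j \in B) && (j != i))).
  apply: eq_bigr => j /andP[_ ji]; case: ltngtP => //= /val_inj E.
  by rewrite E eqxx in ji.
by move=> j; rewrite !inE andbC.
Qed.

Lemma card_edge n : (#|[set: edge n]%SET|.*2 = n * n.-1)%N.
Proof.
have -> : [set: edge n]%SET = clique [set: 'I_n]%SET.
  by apply/setP => e; rewrite !inE.
by rewrite card_clique cardsT card_ord.
Qed.

(** * Long paths between the two prescribed ends *)

(** The greedy path starts at vertex 1 and runs through the [m] inner vertices; vertex [n] is then
    appended. The weight of this forced last step is only known to be nonnegative, hence [a *+ m]
    rather than [a *+ m.+1]. *)
Lemma long_path (R : realDomainType) m (f : edge m.+2 -> R) (a : R) :
  (forall e, 0 <= f e) ->
  exists p (B : {set 'I_m.+2}), [/\ self_avoiding_path p,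
    {in clique B, forall e, f e <= a} &
    a *+ m <= \sum_(e in path_edges p) f e + a *+ #|B|].
Proof.
move=> f0; pose z : 'I_m.+2 := ord_max.
pose s := enum (~: [set ord0; z])%SET.
have w0 i j : 0 <= edge_weight f i j by apply: sumr_ge0.
have z0 : z != ord0 by [].
have us : uniq (ord0 :: s) by rewrite /= enum_uniq mem_enum !inE eqxx.
have ss : size s = m.
  by rewrite -cardE cardsCs finset.setCK cards2 eq_sym z0 card_ord subn2.
have [t [B [ts uB _ iB tB]]] := greedy_path a (edge_weightC f) w0 us.
have up : uniq (ord0 :: rcons t z).
  rewrite -rcons_cons rcons_uniq /= inE (negbTE z0) (perm_uniq ts) /=.
  rewrite !(perm_mem ts) -/(uniq (ord0 :: s)) us andbT.
  by rewrite mem_enum !inE eqxx orbT.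
exists (ord0 :: rcons t z), [set i in B]%SET; split.
- by apply/and4P; split; rewrite ?last_rcons ?eqxx //; exact: uniq_path_neq.
- move=> e; rewrite !inE => /andP[e1 e2].
  rewrite -edge_weightE; apply: iB => //.
  by have := valP e; apply: contraTneq => ->; rewrite ltnn.
have -> : #|[set i in B]%SET| = size B by rewrite cardsE; apply/card_uniqP.
rewrite sum_path_edges // -[in leLHS]ss; apply: (le_trans tB); rewrite lerD2r.
have zr u (r : seq 'I_m.+2) :
    zip (u :: rcons r z) (rcons r z) = rcons (zip (u :: r) r) (last u r, z).
  by elim: r u => //= x r IH u; rewrite IH.
by rewrite zr -cats1 big_cat big_seq1 /= lerDl.
Qed.

(** * The events given by upper bounds on the last passage time *)

Lemma last_passage_time_le d (T : measurableType d) (R : realType)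
    (P : probability T R) m (X : edge m.+2 -> {RV P >-> R}) w c :
  last_passage_time X w <= c <->
  forall p, self_avoiding_path p -> passage_time X p w <= c.
Proof.
split => [Wc p pi|pc].
  apply: le_trans Wc; apply: ub_le_sup; last by exists p.
  (* A real [sup] is meaningful only for a nonempty set with an upper bound; the total absolute
     weight bounds all passage times. *)
  exists (\sum_e `|X e w|) => _ [q _ <-]; rewrite /passage_time big_mkcond /=.
  by apply: ler_sum => e _; case: ifP => // _; exact: ler_norm.
apply: ge_sup => [|_ [p pi <-]]; last exact: pc.
(* Zero weights suffice here: only the existence of a self-avoiding path is wanted. *)
have [|p [B [pi _ _]]] := @long_path R m (fun=> 0) 0; first by [].
by exists (passage_time X p w), p.
Qed.

Lemma measurable_last_passage_time_le d (T : measurableType d) (R : realType)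
    (P : probability T R) m (X : edge m.+2 -> {RV P >-> R}) c :
  measurable [set w | last_passage_time X w <= c].
Proof.
(* Indexing by edge sets instead of vertex sequences makes the intersection visibly finite. *)
have -> : [set w | last_passage_time X w <= c] =
    \bigcap_(S in [set path_edges p | p in [set p | self_avoiding_path p]])
      ((fun w => \sum_(e in S) X e w) @^-1` `]-oo, c]).
  apply/seteqP; split=> w /=.
    by move/last_passage_time_le => h _ [p pi <-]; rewrite /= in_itv /= h.
  move=> h; apply/last_passage_time_le => p pi.
  by have := h (path_edges p); rewrite /= in_itv /=; apply; exists p.
apply: fin_bigcap_measurable => // S _; rewrite -[X in measurable X]setTI.
under eq_fun do rewrite -big_enum.
by apply: measurable_sum.
Qed.

(** * Probability estimates for finite families and for the distribution function *)

Lemma union_bound d (T : measurableType d) (R : realType)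
    (P : probability T R) (I : finType) (D : {pred I}) (A : I -> set T)
    (b : R) :
  0 <= b -> (forall i, measurable (A i)) ->
  (forall i, i \in D -> (P (A i) <= b%:E)%E) ->
  (P (\bigcup_(i in [set` D]) A i) <= (b *+ #|I|)%:E)%E.
Proof.
move=> b0 mA PA; rewrite bigcup_pred.
apply: (@le_trans _ _ (\sum_(i in D) b%:E)%E); last first.
  rewrite sumEFin lee_fin sumr_const ler_wpMn2l//.
  exact: max_card.
suff [] : measurable (\big[setU/set0]_(i in D) A i) /\
  (P (\big[setU/set0]_(i in D) A i) <= \sum_(i in D) b%:E)%E by [].
elim/big_ind2 : _ => [|B x C y [mB PB] [mC PC]|i iD].
- by rewrite measure0.
- split; first exact: measurableU.
  by apply: le_trans (leeD PB PC); exact: measureU2.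
- by split=> //; exact: PA.
Qed.

Lemma iid_cdf d0 (T0 : measurableType d0) (R : realType) (P0 : probability T0 R)
    (xi : {RV P0 >-> R}) d (T : measurableType d) (P : probability T R)
    (I : finType) (X : I -> {RV P >-> R}) (J : {set I}) (c F : R) :
  iid_copies xi X -> cdf xi c = F%:E ->
  P (\bigcap_(i in [set` J]) (X i @^-1` `]-oo, c])) = (F ^+ #|J|)%:E.
Proof.
move=> [iX dX] cF; rewrite (iX J (fun=> `]-oo, c]%classic))//.
rewrite -prodr_const -prodEFin; apply: eq_bigr => i _.
by rewrite -cF; exact: dX.
Qed.

Lemma cdf0_ae_gt0 d (T : measurableType d) (R : realType) (P : probability T R)
    (X : {RV P >-> R}) : {ae P, forall w, 0 < X w} -> cdf X 0 = 0%E.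
Proof.
move=> X0; rewrite -[LHS]/(P (X @^-1` `]-oo, 0])); apply/negligibleP.
  by rewrite -[Y in measurable Y]setTI; exact: measurable_funPT.
by apply: (negligibleS _ X0) => w /=; rewrite in_itv /= leNgt => /negP.
Qed.

(** As [mu] is the infimum of the zeros of the tail, the tail at [a < mu] is positive. So the
    distribution function at [a] lies strictly between 0 and 1 and has a positive exponential
    rate. *)
Lemma cdf_in01 d (T : measurableType d) (R : realType) (P : probability T R)
    (X : {RV P >-> R}) (mu a : R) :
  ess_supr P X = mu%:E -> a < mu -> (ccdf X a < 1)%E ->
  exists2 r : R, 0 < r & cdf X a = (expR (- r))%:E.
Proof.
move=> muE amu c1.
have c0 : (0 < ccdf X a)%E.
  rewrite lt_neqAle measure_ge0 andbT eq_sym; apply/eqP => c0.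
  have : (mu%:E <= a%:E)%E.
    by rewrite -muE ess_sup_ccdf; apply: ereal_inf_lbound; exists a.
  by rewrite lee_fin leNgt amu.
have cf : ccdf X a \is a fin_num by apply: fin_num_measure.
move: c0 c1; rewrite cdf_1_ccdf -(fineK cf) !lte_fin => c0 c1.
exists (- ln (1 - fine (ccdf X a))); first by rewrite oppr_gt0 ln_lt0//; lra.
by rewrite opprK lnK ?EFinB// posrE; lra.
Qed.

Lemma expR_half_exponent (R : realType) (r : R) (k N : nat) :
  (N.*2 = k * k.-1)%N -> expR r ^+ N = expR (r / 2 * (k%:R ^+ 2 - k%:R)).
Proof.
move=> kN; rewrite -expRM_natl; congr expR.
have : N%:R * 2 = k%:R ^+ 2 - k%:R :> R.
  rewrite -natrM muln2 kN; case: k {kN} => [|k]; first by rewrite expr0n subrr.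
  by rewrite /= natrM -natr1; ring.
by move=> <-; field.
Qed.

(** * The two probability bounds for a fixed number of vertices *)

Lemma last_passage_time_ge_prob d0 (T0 : measurableType d0) (R : realType)
    (P0 : probability T0 R) (xi : {RV P0 >-> R}) d (T : measurableType d)
    (P : probability T R) m (X : edge m.+2 -> {RV P >-> R}) (c F : R) :
  iid_copies xi X -> cdf xi c = F%:E -> 0 <= c ->
  ((F ^+ #|[set: edge m.+2]%SET|)%:E
    <= P [set w | last_passage_time X w <= c * m.+2%:R]%R)%E.
Proof.
move=> iid cF c0; rewrite -(iid_cdf _ iid cF); apply: le_measure; rewrite ?inE.
- apply: fin_bigcap_measurable => // e _; rewrite -[X in measurable X]setTI.
  exact: measurable_funPT.
- exact: measurable_last_passage_time_le.
move=> w Xc; apply/last_passage_time_le => -[//|v q] /and4P[_ _ _ uq].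
apply: (@le_trans _ _ (c *+ #|path_edges (v :: q)|)).
  rewrite -sumr_const; apply: ler_sum => e _.
  by have := Xc e; rewrite /= in_itv /= !inE; apply.
(* A path has fewer edges than there are vertices, and [0 <= c] allows rounding their number up to
   [m.+2]. *)
rewrite mulr_natr ler_wpMn2l// (leq_trans (card_path_edges uq))//.
by apply: ltnW; rewrite -[(_ < _)%N]/(size (v :: q) <= _)%N -(card_uniqP uq)
  (leq_trans (max_card _))// card_ord.
Qed.

(** In the hypothesis on [M], [k] stands for the size of a possible stuck set and [N] for the number
    of edges it spans. The factor [2 ^ m.+2] counts the vertex sets. *)
Lemma last_passage_time_le_prob d0 (T0 : measurableType d0) (R : realType)
    (P0 : probability T0 R) (xi : {RV P0 >-> R}) d (T : measurableType d)
    (P : probability T R) m (X : edge m.+2 -> {RV P >-> R}) (a b F M : R) :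
  iid_copies xi X -> cdf xi 0 = 0%E -> cdf xi a = F%:E -> 0 <= M ->
  (forall k N : nat, (N.*2 = k * k.-1)%N ->
    a *+ m <= b + a *+ k -> F ^+ N <= M) ->
  (P [set w | last_passage_time X w <= b]%R <= (M *+ 2 ^ m.+2)%:E)%E.
Proof.
move=> iid c0 cF M0 FM.
have mX e c : measurable (X e @^-1` `]-oo, c]).
  by rewrite -[X in measurable X]setTI; exact: measurable_funPT.
have mC B : measurable (\bigcap_(e in [set` clique B]) (X e @^-1` `]-oo, a])).
  by apply: fin_bigcap_measurable => // e _; exact: mX.
pose D := [pred B : {set 'I_m.+2} | a *+ m <= b + a *+ #|B|].
(* Weights are positive only almost surely, while [long_path] asks for nonnegative ones everywhere;
   the null event [Z] covers the exceptions. *)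
pose Z := \bigcup_(e in [set` predT]) (X e @^-1` `]-oo, 0]).
pose U := \bigcup_(B in [set` D])
  \bigcap_(e in [set` clique B]) (X e @^-1` `]-oo, a]).
have mZ : measurable Z by apply: fin_bigcup_measurable.
have mU : measurable U by apply: fin_bigcup_measurable.
apply: (@le_trans _ _ (P (Z `|` U))).
  apply: le_measure; rewrite ?inE.
  - exact: measurable_last_passage_time_le.
  - exact: measurableU.
  move=> w Wb; have [Zw|nZ] := pselect (Z w); [by left|right].
  have [|p [B [pi lB pB]]] := @long_path R m (X^~ w) a.
    move=> e; rewrite leNgt; apply/negP => /ltW Xe; apply: nZ.
    by exists e => //=; rewrite in_itv.
  exists B => /=; last by move=> e /= eB; rewrite in_itv /= lB.
  rewrite /D inE (le_trans pB)// lerD2r.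
  by move/last_passage_time_le: Wb; apply.
apply: (le_trans (measureU2 _ _ _)) => //; rewrite -[leRHS]add0e leeD//.
  have := @union_bound _ _ _ P _ predT (fun e => X e @^-1` `]-oo, 0]) 0.
  rewrite mul0rn; apply => // e _.
  have := iid.2 e `]-oo, 0]%classic; rewrite -/(cdf xi 0) c0 => Xe0.
  by rewrite -[P _]/(distribution P (X e) _) Xe0.
have -> : (2 ^ m.+2)%N = #|{set 'I_m.+2}|.
  by rewrite -cardsT -powersetT card_powerset cardsT card_ord.
apply: union_bound => // B BD; rewrite (iid_cdf _ iid cF) lee_fin.
exact: FM (card_clique B) BD.
Qed.

Theorem theorem1p4 (R : realType) (d0 : measure_display)
    (T0 : measurableType d0) (P0 : probability T0 R) (xi : {RV P0 >-> R})
    (xi_pos : {ae P0, forall w, 0 < xi w})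
    (mu : R) (mu_ess_sup : ess_supr P0 xi = mu%:E)
    (x : R) (x_gt0 : 0 < x) (x_lt_mu : x < mu)
    (p_lt1 : (ccdf xi (mu - x) < 1)%E) :
  exists C1 c1 C2 c2 : R,
    [/\ 1 < C1, 1 < c1, 0 < C2, C2 < c2 &
      \forall n \near \oo,
        forall (d : measure_display) (T : measurableType d)
          (P : probability T R) (X : edge n -> {RV P >-> R}),
        iid_copies xi X ->
        ((c1 ^+ n * expR (- c2 * n%:R ^+ 2))%R%:E
           <= P [set w | last_passage_time X w / n%:R <= mu - x]%R
           <= (C1 ^+ n * expR (- C2 * n%:R ^+ 2))%R%:E)%E].
Proof.
(* [delta] is chosen so that replacing [delta * n] edges of weight at least
   [a] by edges of weight 0 lowers a path of [n] such edges to weight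
   [(mu - 3 x / 4) n], still above [(mu - x) n]. *)
pose c := mu - x; pose a := mu - x / 2.
have [alpha alpha0 cE] : exists2 r : R, 0 < r & cdf xi c = (expR (- r))%:E.
  by apply: cdf_in01 mu_ess_sup _ p_lt1; rewrite /c; lra.
have [beta beta0 aE] : exists2 r : R, 0 < r & cdf xi a = (expR (- r))%:E.
  apply: cdf_in01 mu_ess_sup _ _; first by rewrite /a; lra.
  by apply: le_lt_trans p_lt1; apply: ccdf_nonincreasing; rewrite /a; lra.
have ab : beta <= alpha.
  have : (cdf xi c <= cdf xi a)%E.
    by apply: cdf_nondecreasing; rewrite /a /c; lra.
  by rewrite cE aE lee_fin ler_expR; lra.
have a0 : 0 < a by rewrite /a; lra.
have c0 : 0 < c by rewrite /c; lra.
pose delta := x / (4 * a).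
have da : delta * a = x / 4 by rewrite /delta; field; rewrite gt_eqF.
have delta0 : 0 < delta by rewrite divr_gt0//; lra.
have delta1 : delta < 1 by rewrite ltr_pdivrMr ?mul1r /a; lra.
clearbody delta.
(* The lower pair expands [- alpha * n * (n - 1) / 2]. The upper pair expands
   [- beta / 2 * (y ^+ 2 - y)] at [y = delta * n], with the 2 coming from the union bound. [C2 < c2]
   follows from [beta <= alpha] and [delta < 1]. *)
exists (2 * expR (beta * delta / 2)), (expR (alpha / 2)),
  (beta * delta ^+ 2 / 2), (alpha / 2); split.
- have : 1 < expR (beta * delta / 2) by rewrite expR_gt1 divr_gt0// mulr_gt0.
  by lra.
- by rewrite expR_gt1 divr_gt0.
- by rewrite divr_gt0// mulr_gt0// exprn_gt0.
- by have : delta ^+ 2 < 1 by [nra]; nra.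
apply: filterS2 (nbhs_infty_gt 1) (nbhs_infty_gtr (8 * a / x)).
move=> [|[|m]]// _ mx d T P X iid.
have -> : [set w | last_passage_time X w / m.+2%:R <= mu - x] =
    [set w | last_passage_time X w <= c * m.+2%:R].
  by apply/seteqP; split=> w /=; rewrite ler_pdivrMr ?ltr0n.
apply/andP; split.
  apply: le_trans (last_passage_time_ge_prob iid cE (ltW c0)).
  rewrite (expR_half_exponent _ (card_edge _)) -expRM_natl -expRD lee_fin.
  by rewrite ler_expR le_eqVlt; apply/orP; left; apply/eqP; field.
pose y := delta * m.+2%:R.
apply: le_trans (last_passage_time_le_prob
  (M := expR (- beta / 2 * (y ^+ 2 - y))) iid (cdf0_ae_gt0 xi_pos) aE
  (ltW (expR_gt0 _)) _) _.
  move=> k N kN; rewrite (expR_half_exponent _ kN) ler_expR => ak.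
  (* By [ak], [a * k] is at least [x / 2 * n - 2 * a], with [n = m + 2]. This exceeds
     [a * y = x / 4 * n] exactly when [n > 8 * a / x]. *)
  have yk : y < k%:R.
    rewrite -(ltr_pM2r a0) /y mulrAC da.
    move: ak mx; rewrite -!(mulr_natr a) /c ltr_pdivrMr// -addn2 natrD /a; lra.
  have k1 : 1 <= k%:R :> R.
    rewrite ler1n -(ltr0n R); apply: le_lt_trans yk.
    by rewrite mulr_ge0// ltW.
  have y0 : 0 <= y by rewrite mulr_ge0// ltW.
  (* This product is the difference of [t ^+ 2 - t] at [k] and at [y]. That function is not monotone
     near 0, so [1 <= k] is used. *)
  have : 0 <= (k%:R - y) * (k%:R + y - 1) by apply: mulr_ge0; lra.
  nra.
rewrite lee_fin -[leLHS]mulr_natl natrX [in leRHS]exprMn -[leRHS]mulrA.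
rewrite ler_pM2l ?exprn_gt0//.
by rewrite -expRM_natl -expRD ler_expR /y le_eqVlt; apply/orP; left; apply/eqP;
  field.
Qed.
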